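(* Let $\mu=\mu_1\times\dots\times\mu_K$ be a product-form probability distribution on $(S,\mathcal{S})$. If $\varphi\in L^2_\mu$ and $\sigma^2(\varphi):=\mu([\varphi-\mu(\varphi)]^2)$ denotes the asymptotic variance of the standard estimator $\mu^N(\varphi)$, then $$\mathrm{Var}(\mu^N_\times(\varphi))\leq\frac{\sigma^2(\varphi)}{N}=\mathrm{Var}(\mu^N(\varphi))\quad\forall N>0,\qquad \sigma^2_\times(\varphi)\leq\sigma^2(\varphi).$$
   Context: $K>1$ is an integer, $[K]:=\{1,\dots,K\}$. For $k\in[K]$, $\mu_k$ is a probability distribution on a measurable space $(S_k,\mathcal{S}_k)$; $S:=S_1\times\dots\times S_K$ with product sigma-algebra $\mathcal{S}$. $\mu(\varphi):=\int\varphi\,d\mu$; $L^2_\mu$ is the space of square $\mu$-integrable real-valued functions. Given i.i.d. samples $X^n=(X^n_1,\dots,X^n_K)$, $n=1,\dots,N$, with law $\mu$, the standard estimator is $\mu^N(\varphi):=N^{-1}\sum_{n=1}^N\varphi(X^n)$ and the product-form estimator is $\mu^N_\times(\varphi):=N^{-K}\sum_{\mathbf{n}\in[N]^K}\varphi(X^{\mathbf{n}})$, where $X^{\mathbf{n}}:=(X^{n_1}_1,\dots,X^{n_K}_K)$. The asymptotic variance of the latter is $\sigma^2_\times(\varphi):=\sum_{k=1}^K\mu_k([\mu_{\{k\}^c}(\varphi)-\mu(\varphi)]^2)$, where $\mu_{\{k\}^c}(\varphi)$ is the function on $S_k$ obtained by integrating out all arguments of $\varphi$ except the $k$-th with respect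 to $\prod_{l\neq k}\mu_l$. Partial integrals of $\varphi$ against products of the $\mu_l$'s are assumed well-defined at every point. *)

(* Defs.v *)
From HB Require Import structures.
From mathcomp Require Import all_boot all_order all_algebra.
From mathcomp Require Import all_classical all_reals all_analysis.

Set Implicit Arguments.
Unset Strict Implicit.
Unset Printing Implicit Defensive.

Import Order.TTheory GRing.Theory Num.Theory.
Import numFieldNormedType.Exports.

Local Open Scope classical_set_scope.
Local Open Scope ring_scope.

Definition pspace_display (I : Type) (d : I -> measure_display) :
  measure_display.
Proof. exact: default_measure_display. Qed.

(* The product of the spaces T i, with the sigma-algebra generated by the
   coordinate maps. *)
Definition pspace (I : Type) (d : I -> measure_display)
  (T : forall i, measurableType (d i)) := forall i, T i.

Section pspace_measurable.
Context {I : Type} {d : I -> measure_display}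
  (T : forall i, measurableType (d i)).

Definition pspace_generator : set (set (pspace T)) :=
  \bigcup_i preimage_set_system [set: pspace T] (fun x => x i) measurable.

HB.instance Definition _ := gen_eqMixin (pspace T).
HB.instance Definition _ := gen_choiceMixin (pspace T).
HB.instance Definition _ := isPointed.Build (pspace T) (fun=> point).

Let pspace0 : <<s pspace_generator >> set0.
Proof. exact: sigma_algebra0. Qed.

Let pspaceC A : <<s pspace_generator >> A -> <<s pspace_generator >> (~` A).
Proof. exact: sigma_algebraC. Qed.

Let pspaceU (F : (set (pspace T))^nat) :
  (forall i, <<s pspace_generator >> (F i)) ->
  <<s pspace_generator >> (\bigcup_i F i).
Proof. exact: sigma_algebra_bigcup. Qed.

HB.instance Definition _ := @isMeasurable.Build (pspace_display d) (pspace T)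
  <<s pspace_generator >> pspace0 pspaceC pspaceU.

End pspace_measurable.

Definition box (I : Type) (d : I -> measure_display)
    (T : forall i, measurableType (d i)) (A : forall i, set (T i)) :
    set (pspace T) :=
  [set x | forall i, A i (x i)].

Lemma measurable_coord (I : Type) (d : I -> measure_display)
    (T : forall i, measurableType (d i)) (i : I) :
  measurable_fun [set: pspace T] (fun x => x i).
Proof.
move=> _ A mA; apply: sub_sigma_algebra; exists i => //.
by exists A.
Qed.

Lemma measurable_pspaceP (I : Type) (d : I -> measure_display)
    (T : forall i, measurableType (d i))
    (d' : measure_display) (U : measurableType d') (f : U -> pspace T) :
  (forall i, measurable_fun [set: U] (fun u => f u i)) ->
  measurable_fun [set: U] f.
Proof.
move=> mf.
apply: (@measurability _ _ U (pspace T) setT f (@pspace_generator I d T) erefl).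
move=> _ [_ [i _ [A mA <-]] <-].
by rewrite [X in _ `&` (_ @^-1` X)]setTI; exact: mf.
Qed.

Lemma measurable_box (I : finType) (d : I -> measure_display)
    (T : forall i, measurableType (d i)) (A : forall i, set (T i)) :
  (forall i, measurable (A i)) -> measurable (box A).
Proof.
move=> mA.
have -> : box A = \bigcap_(i in [set: I]) ((fun x : pspace T => x i) @^-1` A i).
  by apply/seteqP; split => x /= => [Ax i _|Ax i]; exact: Ax.
apply: fin_bigcap_measurable => // i _.
by rewrite -[X in measurable X]setTI; exact: measurable_coord.
Qed.

Section product_probability.
Local Open Scope ereal_scope.
Context {R : realType} {I : finType} {d : I -> measure_display}
  {T : forall i, measurableType (d i)} (P : forall i, probability (T i) R).

Definition resample (i : I) (u : pspace T * T i) : pspace T := eqtype.dfwith u.1 u.2.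

Let measurable_resample i : measurable_fun setT (@resample i).
Proof.
apply: measurable_pspaceP => j.
have [ij|ij] := eqVneq i j.
  case: j / ij.
  have -> : (fun u => @resample i u i) = snd.
    by apply/funext => u; rewrite /resample dfwith_in.
  exact: measurable_snd.
have -> : (fun u => @resample i u j) = (fun x : pspace T => x j) \o fst.
  by apply/funext => u; rewrite /resample dfwith_out.
by apply: measurableT_comp; [exact: measurable_coord|exact: measurable_fst].
Qed.

HB.instance Definition _ i :=
  @isMeasurableFun.Build _ _ _ _ (@resample i) (@measurable_resample i).

Fixpoint prod_prob_seq (s : seq I) : probability (pspace T) R :=
  if s is i :: s' then distribution (prod_prob_seq s' \x P i) (@resample i)
  else \d_(point : pspace T).

(* The product of the P i, obtained from a Dirac mass by resampling all the
   coordinates one after the other; prod_probE characterises it. *)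
Definition prod_prob : probability (pspace T) R := prod_prob_seq (enum I).

Let prod_prob_seqE (s : seq I) (A : forall i, set (T i)) :
  uniq s -> (forall i, measurable (A i)) ->
  prod_prob_seq s (box A) = \prod_(i <- s) P i (A i) *
    \d_(point : pspace T) (box (fun i => if i \in s then setT else A i)).
Proof.
elim: s A => [|i s IH] A /=.
  by move=> _ mA; rewrite big_nil mul1e.
move=> /andP[ins us] mA.
pose B : forall i, set (T i) := eqtype.dfwith A (setT : set (T i)).
have mB j : measurable (B j).
  by rewrite /B; case: eqtype.dfwithP => [|j' _]; [exact: measurableT|exact: mA].
have BE j : j \in s -> B j = A j.
  by move=> js; rewrite /B dfwith_out//; apply: contraNneq ins => ->.
rewrite /distribution /pushforward.
have -> : @resample i @^-1` box A = box B `*` A i.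
  apply/seteqP; split => -[x t]; rewrite /resample /box /=.
    move=> Ax; split => [j|]; last by have := Ax i; rewrite dfwith_in.
    rewrite /B; case: eqtype.dfwithP => // j' ij'.
    by have := Ax j'; rewrite dfwith_out.
  move=> [Bx Ait] j; case: eqtype.dfwithP => // j' ij'.
  by have := Bx j'; rewrite /B dfwith_out.
transitivity (prod_prob_seq s (box B) * P i (A i)).
  by apply: product_measure1E => //; exact: measurable_box.
rewrite IH// big_cons muleC muleA.
congr (_ * _ * _).
  by apply: eq_big_seq => j js; rewrite BE.
congr (dirac _ (box _)); apply: functional_extensionality_dep => j.
have [<-|ij] := eqVneq i j.
  by rewrite mem_head (negbTE ins) /B dfwith_in.
by rewrite in_cons eq_sym (negbTE ij)/= /B dfwith_out.
Qed.

Lemma prod_probE (A : forall i, set (T i)) :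
  (forall i, measurable (A i)) -> prod_prob (box A) = \prod_i P i (A i).
Proof.
move=> mA; rewrite /prod_prob prod_prob_seqE ?enum_uniq// big_enum.
rewrite diracE mem_set ?mule1// => i /=.
by rewrite mem_enum.
Qed.

End product_probability.

Section partial_integrals.
Context {R : realType} {K : nat} {d : 'I_K -> measure_display}
  {S : forall k, measurableType (d k)} (P : forall k, probability (S k) R).
Implicit Types (A : {set 'I_K}) (phi : pspace S -> R).

Definition subpspace A := pspace (fun j : {k | k \in A} => S (val j)).

Definition sub_prod_prob A : probability (subpspace A) R :=
  prod_prob (fun j : {k | k \in A} => P (val j)).

Definition glue A (x : subpspace (~: A)) (y : subpspace A) : pspace S :=
  fun k => match @idP (k \in A) with
           | ReflectT kA => y (exist _ k kA)
           | ReflectF kA => x (exist _ k (introT setCP kA))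
           end.

Definition partial_integral A phi (x : subpspace (~: A)) : R :=
  \int[sub_prod_prob A]_y phi (glue x y).

(* A real-valued Lebesgue integral is well defined when the integrand is
   absolutely integrable. *)
Definition partial_integrals_defined phi := forall A (x : subpspace (~: A)),
  (sub_prod_prob A).-integrable setT (EFin \o (phi \o glue x)).

Lemma mem_setCC1 (k j : 'I_K) : j \in (~: [set~ k])%SET -> k = j.
Proof. by rewrite finset.setCK finset.inE => /eqP. Qed.

(* The identification of S k with the product over the complement of
   [set~ k]. *)
Definition single k (t : S k) : subpspace (~: [set~ k])%SET :=
  fun j => ecast i (S i) (mem_setCC1 (valP j)) t.

(* The function on S k obtained by integrating out all the other arguments. *)
Definition marginal phi k (t : S k) : R :=
  partial_integral (A := [set~ k]%SET) phi (single t).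

Lemma glue_in A (x : subpspace (~: A)) (y : subpspace A) (j : {k | k \in A}) :
  glue x y (val j) = y j.
Proof.
rewrite /glue; case: j => k kA /=; case: {-}_ / idP => //= kA'.
by rewrite (bool_irrelevance kA' kA).
Qed.

Lemma glue_notin A (x : subpspace (~: A)) (y : subpspace A)
  (j : {k | k \in ~: A}) : glue x y (val j) = x j.
Proof.
rewrite /glue; case: j => k kA /=; case: {-}_ / idP => //= kA'.
  by exfalso; move: kA; rewrite finset.inE kA'.
congr (x (exist _ _ _)); exact: bool_irrelevance.
Qed.

Lemma glue_single k (t : S k) (y : subpspace [set~ k]%SET) :
  glue (single t) y k = t.
Proof.
have kk : k \in (~: [set~ k])%SET by rewrite finset.setCK finset.inE.
rewrite (glue_notin (single t) y (exist _ k kk) : glue _ _ k = _).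
by rewrite /single eq_axiomK.
Qed.

End partial_integrals.

Definition mutually_independent (d d' : measure_display)
    (Omega : measurableType d) (T : measurableType d') (R : realType)
    (Pr : probability Omega R) (I : finType) (X : I -> {mfun Omega >-> T}) :=
  forall (J : {set I}) (B : I -> set T), (forall i, measurable (B i)) ->
    (Pr (\bigcap_(i in [set` J]) X i @^-1` B i) =
     \prod_(i in J) Pr (X i @^-1` B i))%E.

Definition iid_sample (d d' : measure_display)
    (Omega : measurableType d) (T : measurableType d') (R : realType)
    (Pr : probability Omega R) (law : probability T R) (N : nat)
    (X : 'I_N -> {mfun Omega >-> T}) :=
  (forall n (A : set T), measurable A -> distribution Pr (X n) A = law A) /\
  mutually_independent Pr X.

Section estimators.
Context {R : realType} {K : nat} {d : 'I_K -> measure_display}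
  {S : forall k, measurableType (d k)}.
Implicit Types phi : pspace S -> R.

Definition standard_estimator (Omega : Type) (N : nat)
    (X : 'I_N -> Omega -> pspace S) phi (w : Omega) : R :=
  N%:R^-1 * \sum_(n < N) phi (X n w).

Definition product_estimator (Omega : Type) (N : nat)
    (X : 'I_N -> Omega -> pspace S) phi (w : Omega) : R :=
  N%:R ^- K * \sum_(n : {ffun 'I_K -> 'I_N}) phi (fun k => X (n k) w k).

Definition mean (mu : probability (pspace S) R) phi : R := \int[mu]_x phi x.

Definition sigma2 (mu : probability (pspace S) R) phi : \bar R :=
  (\int[mu]_x ((phi x - mean mu phi) ^+ 2)%:E)%E.

Definition sigma2_prod (P : forall k, probability (S k) R) phi : \bar R :=
  (\sum_(k < K)
    \int[P k]_t ((marginal P phi t - mean (prod_prob P) phi) ^+ 2)%:E)%E.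

End estimators.

(* Main.v *)
From HB Require Import structures.
Require Import Defs.
From mathcomp Require Import all_boot all_order all_algebra.
From mathcomp Require Import all_classical all_reals all_analysis.
From mathcomp Require Import measurable_realfun.

Import Order.TTheory GRing.Theory Num.Theory.
Import numFieldNormedType.Exports.

Local Open Scope classical_set_scope.
Local Open Scope ring_scope.

Set Implicit Arguments.
Unset Strict Implicit.
Unset Printing Implicit Defensive.

(** Finite samples.  Call two multi-indices n and m disjoint when n k <> m k
    for every k.  The recombined points X^n and X^m then read disjoint sets of
    entries of the array (X_k^i), so they are independent, each with law mu
    ([has_law_recombine_pair]).  Hence, if n_1, ..., n_N are pairwise
    disjoint, the average of phi over the points X^(n_s) has variance
    sigma^2(phi) / N ([variance_disjoint_average]).  The standard estimator is
    the case where n_s is constantly s.  The product-form estimator is an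
    average of such averages: for each n, the cyclic shifts
    n + s = (n_1 + s, ..., n_K + s), with s in Z/N, are pairwise disjoint, and
    each multi-index is reached equally often when n and s vary
    ([product_estimator_shifts]).  Averaging random variables whose variances
    are at most v gives a variance at most v ([variance_average_le], from
    Cauchy-Schwarz), hence the first inequality.

    Asymptotic variances.  Let h_k(x) be the marginal of phi at x_k, which is
    the conditional expectation of phi given x_k.  Under mu the h_k are
    uncorrelated, since the coordinates are independent, and
    Cov(phi, h_k) = Var(h_k) by Fubini ([covariance_main_effect]).  So
    sigma^2_x(phi) is the sum of the Var(h_k), which Bessel's inequality
    ([bessel]) bounds by Var(phi) = sigma^2(phi).

    Both halves identify laws on a product space from their values on boxes
    ([box_measure_unique]). *)

(** * Transfer of integrals and moments along laws *)

Section law.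
Local Open Scope ereal_scope.
Context {d d' : measure_display} {T : measurableType d}
  {U : measurableType d'} {R : realType}.
Variables (P : probability T R) (Q : probability U R).

Definition has_law (Y : T -> U) : Prop :=
  measurable_fun [set: T] Y /\ forall A, measurable A -> P (Y @^-1` A) = Q A.

Variables (Y : T -> U) (lawY : has_law Y).

(** The identity for nonnegative functions applies separately to the positive
    and the negative part of f. *)
Lemma integral_law (f : U -> \bar R) : measurable_fun [set: U] f ->
  \int[P]_x f (Y x) = \int[Q]_y f y.
Proof.
case: lawY => mY QY mf.
have ge0 (g : U -> \bar R) : measurable_fun [set: U] g -> (forall y, 0 <= g y) ->
    \int[P]_x g (Y x) = \int[Q]_y g y.
  move=> mg g0.
  rewrite -[LHS](@ge0_integral_pushforward _ _ _ _ _ _ mY P setT g)//.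
  by apply: eq_measure_integral => A mA _; exact: QY.
rewrite integralE [RHS]integralE.
rewrite -[fun x => f (Y x)]/(f \o Y).
under eq_integral do rewrite funepos_comp.
under [X in _ - X = _]eq_integral do rewrite funeneg_comp.
by congr (_ - _); apply: ge0 => //;
  [exact: measurable_funepos|exact: measurable_funeneg].
Qed.

Lemma expectation_law (f : U -> R) : measurable_fun [set: U] f ->
  'E_P[f \o Y] = 'E_Q[f].
Proof.
move=> mf; rewrite unlock (integral_law (f := EFin \o f))//.
exact/measurable_EFinP.
Qed.

Lemma variance_law (f : U -> R) : measurable_fun [set: U] f ->
  'V_P[f \o Y] = 'V_Q[f].
Proof.
move=> mf; rewrite /variance covariance.unlock (expectation_law mf).
pose g u := ((f u - fine 'E_Q[f]) * (f u - fine 'E_Q[f]))%R.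
have mg : measurable_fun [set: U] g.
  by apply: measurable_funM; exact: measurable_funB.
exact: (expectation_law mg).
Qed.

End law.

Section square_integrable.
Local Open Scope ereal_scope.
Context {d : measure_display} {T : measurableType d} {R : realType}.
Variable P : probability T R.
Implicit Types f : T -> R.

Lemma Lfun_measurable p f : f \in Lfun P p -> measurable_fun [set: T] f.
Proof. by rewrite inE => /andP[/[!inE]]. Qed.

Lemma Lfun2_Lfun1 f : f \in Lfun P 2%:E -> f \in Lfun P 1.
Proof. by apply: Lfun_subset12; rewrite fin_num_measure. Qed.

Lemma Lfun2P f : measurable_fun [set: T] f -> \int[P]_x (f x ^+ 2)%:E < +oo ->
  f \in Lfun P 2%:E.
Proof.
move=> mf f2; rewrite inE; apply/andP; split; rewrite inE//=.
rewrite /finite_norm unlock /Lnorm poweR_lty//.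
congr (_ < +oo): f2; apply: eq_integral => x _ /=.
by rewrite powR_mulrn// real_normK// num_real.
Qed.

Lemma Lfun2_lty f : f \in Lfun P 2%:E -> \int[P]_x (f x ^+ 2)%:E < +oo.
Proof.
move=> /Lfun2_integrable_sqr/integrableP[_] f2.
congr (_ < +oo): f2; apply: eq_integral => x _ /=.
by rewrite ger0_norm// sqr_ge0.
Qed.

(** Jensen's inequality for the square.  It is stated in the extended reals
    because it is applied to the slices of a square integrable function, not
    all of which need be square integrable. *)
Lemma sqr_expectation_le f : f \in Lfun P 1 ->
  ((fine 'E_P[f]) ^+ 2)%:E <= \int[P]_x (f x ^+ 2)%:E.
Proof.
move=> f1; have mf := Lfun_measurable f1.
have [->|] := eqVneq (\int[P]_x (f x ^+ 2)%:E) +oo; first exact: leey.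
rewrite -ltey => /(Lfun2P mf) f2.
have := variance_ge0 P f; rewrite varianceE// -(fineK (expectation_fin_num f1)).
by rewrite -EFin_expe sube_ge0// expectation.unlock.
Qed.

End square_integrable.

Section law_Lfun.
Local Open Scope ereal_scope.
Context {d d' : measure_display} {T : measurableType d}
  {U : measurableType d'} {R : realType}.
Variables (P : probability T R) (Q : probability U R) (Y : T -> U).
Hypothesis lawY : has_law P Q Y.

Lemma Lfun2_law (f : U -> R) : f \in Lfun Q 2%:E -> f \o Y \in Lfun P 2%:E.
Proof.
move=> f2; have mf := Lfun_measurable f2; apply: Lfun2P.
  by apply: measurableT_comp => //; case: lawY.
rewrite (integral_law lawY (f := fun y => (f y ^+ 2)%:E)); first exact: Lfun2_lty.
by apply/measurable_EFinP; exact: measurable_funX.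
Qed.

End law_Lfun.

Section product_law.
Local Open Scope ereal_scope.
Context {d d1 d2 : measure_display} {T : measurableType d}
  {U1 : measurableType d1} {U2 : measurableType d2} {R : realType}.
Variables (P : probability T R) (Q1 : probability U1 R) (Q2 : probability U2 R).
Variables (Y1 : T -> U1) (Y2 : T -> U2).
Hypotheses (law1 : has_law P Q1 Y1) (law2 : has_law P Q2 Y2).

Lemma has_law_pair :
  (forall A B, measurable A -> measurable B ->
    P (Y1 @^-1` A `&` Y2 @^-1` B) = Q1 A * Q2 B) ->
  has_law P (Q1 \x Q2)%E (fun w => (Y1 w, Y2 w)).
Proof.
move=> PAB.
have mY : measurable_fun [set: T] (fun w => (Y1 w, Y2 w)).
  by apply: measurable_fun_pair; [case: law1|case: law2].
split=> // A mA.
pose mY_mixin := isMeasurableFun.Build _ _ _ _ _ mY.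
pose Y : {mfun T >-> (U1 * U2)%type} := HB.pack (fun w => (Y1 w, Y2 w)) mY_mixin.
by apply/esym; exact: (product_measure_unique (m' := distribution P Y)).
Qed.

Hypothesis law12 : has_law P (Q1 \x Q2)%E (fun w => (Y1 w, Y2 w)).

(** Fubini factors the expectation of f(Y1) g(Y2); it applies because this
    product is integrable on the sample space, by Hoelder, and integrability
    only depends on the law. *)
Lemma covariance_pair (f : U1 -> R) (g : U2 -> R) :
    f \in Lfun Q1 2%:E -> g \in Lfun Q2 2%:E ->
  covariance P (f \o Y1) (g \o Y2) = 0.
Proof.
move=> f2 g2.
have mf := Lfun_measurable f2; have mg := Lfun_measurable g2.
have fY := Lfun2_law law1 f2; have gY := Lfun2_law law2 g2.
have fgY := Lfun2_mul_Lfun1 fY gY.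
pose h (z : U1 * U2) := (f z.1 * g z.2)%:E.
have mh : measurable_fun [set: (U1 * U2)%type] h.
  apply/measurable_EFinP; apply: measurable_funM.
    exact: measurableT_comp mf measurable_fst.
  exact: measurableT_comp mg measurable_snd.
have ih : (Q1 \x Q2).-integrable setT h.
  apply/integrableP; split => //.
  rewrite -(integral_law law12 (f := abse \o h)); last exact: measurableT_comp.
  by have /Lfun1_integrable/integrableP[] := fgY.
rewrite (covarianceE (Lfun2_Lfun1 fY) (Lfun2_Lfun1 gY) fgY).
rewrite [X in X - _](_ : _ = 'E_Q1[f] * 'E_Q2[g]); last first.
  rewrite expectation.unlock (integral_law law12 (f := h))//.
  rewrite -integral12_prod_meas1//.
  rewrite /fubini_F /h /=.
  under eq_integral do under eq_integral do rewrite EFinM.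
  under eq_integral do rewrite integralZl// -?Lfun1_integrable ?Lfun2_Lfun1//.
  have Eg : \int[Q2]_x (g x)%:E \is a fin_num.
    by have := expectation_fin_num (Lfun2_Lfun1 g2); rewrite expectation.unlock.
  rewrite -(fineK Eg) integralZr//; exact/Lfun1_integrable/Lfun2_Lfun1.
rewrite (expectation_law law1)// (expectation_law law2)// subee//.
by rewrite fin_numM ?expectation_fin_num ?Lfun2_Lfun1.
Qed.

End product_law.

(** * Variances of sums of random variables *)

Section variance_sums.
Local Open Scope ereal_scope.
Context {d : measure_display} {T : measurableType d} {R : realType}.
Variables (P : probability T R) (I : finType).
Implicit Types (X : T -> R) (Y : I -> T -> R).

Lemma Lfun2_sum Y : (forall i, Y i \in Lfun P 2%:E) ->
  (\sum_i Y i)%R \in Lfun P 2%:E.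
Proof.
by move=> Y2; rewrite rpred_sum ?lee1n.
Qed.

Lemma covariance_suml X Y : X \in Lfun P 2%:E ->
  (forall i, Y i \in Lfun P 2%:E) ->
  covariance P (\sum_i Y i)%R X = \sum_i covariance P (Y i) X.
Proof.
move=> X2 Y2; elim: (index_enum I) => [|i s IHs].
  by rewrite !big_nil; exact: covariance_cst_l.
rewrite !big_cons covarianceDl ?IHs//.
by rewrite rpred_sum ?lee1n.
Qed.

Lemma covariance_sumr X Y : X \in Lfun P 2%:E ->
  (forall i, Y i \in Lfun P 2%:E) ->
  covariance P X (\sum_i Y i)%R = \sum_i covariance P X (Y i).
Proof.
move=> X2 Y2; rewrite covarianceC covariance_suml//.
by apply: eq_bigr => i _; rewrite covarianceC.
Qed.

Lemma variance_sum Y : (forall i, Y i \in Lfun P 2%:E) ->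
  'V_P[(\sum_i Y i)%R] = \sum_i \sum_j covariance P (Y i) (Y j).
Proof.
move=> Y2; rewrite /variance covariance_suml//; last exact: Lfun2_sum.
by apply: eq_bigr => i _; rewrite covariance_sumr.
Qed.

Lemma variance_sum_uncorrelated Y : (forall i, Y i \in Lfun P 2%:E) ->
    (forall i j, i != j -> covariance P (Y i) (Y j) = 0) ->
  'V_P[(\sum_i Y i)%R] = \sum_i 'V_P[Y i].
Proof.
move=> Y2 Y0; rewrite variance_sum//; apply: eq_bigr => i _.
rewrite (bigD1 i)//= big1 ?adde0// => j ji.
by rewrite Y0// eq_sym.
Qed.

(** Each of the covariances is at most v by Cauchy-Schwarz, and there are
    #|I|^2 of them. *)
Lemma variance_average_le Y (v : R) : (0 < #|I|)%N ->
    (forall i, Y i \in Lfun P 2%:E) -> (forall i, 'V_P[Y i] <= v%:E) ->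
  'V_P[(#|I|%:R^-1 \o* (\sum_i Y i))%R] <= v%:E.
Proof.
move=> I0 Y2 Yv.
have v0 : 0 <= v%:E.
  by have /card_gt0P[i _] := I0; rewrite (le_trans _ (Yv i))// variance_ge0.
rewrite varianceZ; last exact: Lfun2_sum.
have -> : v%:E = (#|I|%:R^-1 ^+ 2)%:E * (\sum_(i in I) \sum_(j in I) v%:E).
  under eq_bigr do rewrite sumEFin.
  rewrite sumEFin -EFinM; congr (_%:E).
  rewrite !sumr_const -mulrnA -(mulr_natr v) natrM -expr2 mulrCA exprVn.
  by rewrite mulVf ?mulr1// expf_eq0/= pnatr_eq0 -lt0n.
rewrite lee_wpmul2l// ?lee_fin ?sqr_ge0//.
rewrite variance_sum// lee_sum// => i _; rewrite lee_sum// => j _.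
rewrite (le_trans (covariance_le (Y2 i) (Y2 j)))//.
have -> : v%:E = sqrte v%:E * sqrte v%:E by rewrite -expe2 sqr_sqrte.
by rewrite lee_pmul ?sqrte_ge0// lee_sqrt.
Qed.

(** For the covariance form the Y i are orthogonal, and Cov(X, Y i) = Var(Y i)
    makes their sum the projection of X on their span: expanding Var(X - sum Y i) >= 0 gives the
    bound. *)
Lemma bessel X Y : X \in Lfun P 2%:E -> (forall i, Y i \in Lfun P 2%:E) ->
    (forall i j, i != j -> covariance P (Y i) (Y j) = 0) ->
    (forall i, covariance P X (Y i) = 'V_P[Y i]) ->
  \sum_i 'V_P[Y i] <= 'V_P[X].
Proof.
move=> X2 Y2 Y0 XY.
have sY2 := Lfun2_sum Y2.
have := variance_ge0 P (X \- (\sum_i Y i)%R)%R.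
rewrite varianceB// covariance_sumr// (eq_bigr _ (fun i _ => XY i)).
have := variance_fin_num sY2.
rewrite variance_sum_uncorrelated//.
have := variance_fin_num X2.
move: (variance P X) (\sum_i _) => [x| |]// [s| |]// _ _.
rewrite -[X in 0 <= X -> _]/((x + s - 2 * s)%:E) !lee_fin => h.
by rewrite -subr_ge0 (le_trans h)// mulr_natl mulr2n opprD addrACA subrr addr0.
Qed.

End variance_sums.

(** * Laws on product spaces are determined by boxes *)

Section boxes.
Local Open Scope ereal_scope.
Context {R : realType} {I : finType} {d : I -> measure_display}
  {T : forall i, measurableType (d i)}.

Lemma cylinder_box (i : I) (A : set (T i)) :
  [set x : pspace T | A (x i)] =
  box (eqtype.dfwith (fun j => [set: T j]) A).
Proof.
apply/seteqP; split => x /= Ax.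
  by move=> j; case: eqtype.dfwithP.
by have := Ax i; rewrite dfwith_in.
Qed.

(** Boxes are closed under intersection, and contain the cylinders that
    generate the product sigma-algebra: this is Dynkin's uniqueness theorem. *)
Lemma box_measure_unique (m1 m2 : {measure set (pspace T) -> \bar R}) :
    m1 setT < +oo ->
    (forall B : forall i, set (T i), (forall i, measurable (B i)) ->
      m1 (box B) = m2 (box B)) ->
  forall A, measurable A -> m1 A = m2 A.
Proof.
move=> m1oo m12 A mA.
pose G : set (set (pspace T)) :=
  [set box B | B in [set B : forall i, set (T i) | forall i, measurable (B i)]].
have GT : G setT.
  by exists (fun i => setT) => [i|]; [exact: measurableT|exact/seteqP].
apply: (@measure_unique _ R (pspace T) G (fun=> setT)) => //.
- apply/seteqP; split.
    apply: smallest_sub; first exact: smallest_sigma_algebra.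
    move=> _ [i _ [C mC <-]]; rewrite setTI; apply: sub_sigma_algebra.
    rewrite -[X in G X]/([set x : pspace T | C (x i)]) cylinder_box.
    by eexists; [|reflexivity] => j /=; case: eqtype.dfwithP.
  apply: smallest_sub; first exact: sigma_algebra_measurable.
  by move=> _ [B mB <-]; exact: measurable_box.
- move=> _ _ [B mB <-] [C mC <-]; exists (fun i => B i `&` C i) => [i|].
    exact: measurableI.
  by apply/seteqP; split=> x /= => [BC|[Bx Cx] i]; [split=> i; case: (BC i)|split].
- by rewrite bigcup_const.
- by move=> _ [B mB <-]; exact: m12.
Qed.

Lemma has_law_box {d0} {W : measurableType d0} (P : probability W R)
    (Q : probability (pspace T) R) (Y : W -> pspace T) :
    measurable_fun [set: W] Y ->
    (forall B : forall i, set (T i), (forall i, measurable (B i)) ->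
      P (Y @^-1` box B) = Q (box B)) ->
  has_law P Q Y.
Proof.
move=> mY PQ; split=> //.
pose mY_mixin := isMeasurableFun.Build _ _ _ _ _ mY.
pose Y' : {mfun W >-> pspace T} := HB.pack Y mY_mixin.
apply: (@box_measure_unique (distribution P Y') Q) => //=.
by rewrite -ge0_fin_numE// fin_num_measure.
Qed.

(** The rectangles A x B with measurable sides are reached from the boxes by
    applying [box_measure_unique] to one side at a time: with B fixed, both
    members are finite measures in A. *)
Lemma has_law_pair_box {d0} {W : measurableType d0} (P : probability W R)
    (Q : probability (pspace T) R) (Y Z : W -> pspace T) :
    has_law P Q Y -> has_law P Q Z ->
    (forall B C : forall i, set (T i),
      (forall i, measurable (B i)) -> (forall i, measurable (C i)) ->
      P (Y @^-1` box B `&` Z @^-1` box C) = Q (box B) * Q (box C)) ->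
  has_law P (Q \x Q) (fun w => (Y w, Z w)).
Proof.
move=> lawY lawZ PYZ; apply: has_law_pair => //.
have half (U V : W -> pspace T) (B : set (pspace T)) : has_law P Q U ->
    has_law P Q V -> measurable B ->
    (forall C, (forall i, measurable (C i)) ->
      P (U @^-1` box C `&` V @^-1` B) = Q (box C) * Q B) ->
    forall A, measurable A -> P (U @^-1` A `&` V @^-1` B) = Q A * Q B.
  move=> [mU _] [mV _] mB PUB A mA.
  have mVB : measurable (V @^-1` B) by rewrite -[_ @^-1` _]setTI; exact: mV.
  pose mU_mixin := isMeasurableFun.Build _ _ _ _ _ mU.
  pose U' : {mfun W >-> pspace T} := HB.pack U mU_mixin.
  (* The measures to compare are A |-> P(U in A, V in B) and A |-> Q B * Q A. *)
  have QB0 : (0 <= fine (Q B))%R by rewrite fine_ge0.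
  pose m1 := pushforward (mrestr P mVB) U'.
  pose m2 := mscale (NngNum QB0) Q.
  transitivity (m2 A); last first.
    by rewrite /m2 /mscale/= fineK ?fin_num_measure// muleC.
  apply: (@box_measure_unique m1 m2) => //=.
    rewrite /m1 /pushforward /mrestr.
    by rewrite preimage_setT setTI -ge0_fin_numE// fin_num_measure.
  move=> C mC; rewrite /m1 /m2 /pushforward /mrestr /mscale/= PUB//.
  by rewrite fineK ?fin_num_measure// muleC.
move=> A B mA mB; apply: (half Y Z B) => // C mC.
(* The side that still ranges over measurable sets is now B, tested against
   the box C. *)
rewrite setIC muleC; apply: (half Z Y) => //; first exact: measurable_box.
by move=> D mD; rewrite setIC muleC PYZ.
Qed.

End boxes.

(** * Recombined samples *)

Lemma sigma2_variance {R : realType} {K : nat} {d : 'I_K -> measure_display}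
    {S : forall k, measurableType (d k)} (mu : probability (pspace S) R)
    (phi : pspace S -> R) :
  sigma2 mu phi = variance mu phi.
Proof. by rewrite /sigma2 /variance covariance.unlock !expectation.unlock. Qed.

Section samples.
Local Open Scope ereal_scope.
Context {R : realType} {K N : nat} {d : 'I_K -> measure_display}
  {S : forall k, measurableType (d k)} (mu_ : forall k, probability (S k) R)
  {dO : measure_display} {Omega : measurableType dO}
  (Pr : probability Omega R) (X : 'I_N -> {mfun Omega >-> pspace S}).
Hypothesis hX : iid_sample Pr (prod_prob mu_) X.
Local Notation mu := (prod_prob mu_).

Definition recombine (n : 'I_K -> 'I_N) (w : Omega) : pspace S :=
  fun k => X (n k) w k.

Lemma measurable_recombine n : measurable_fun [set: Omega] (recombine n).
Proof.
apply: measurable_pspaceP => k.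
have mX : measurable_fun [set: Omega] (X (n k)) by [].
exact: (measurableT_comp (@measurable_coord _ _ S k) mX).
Qed.

(** Independence over i comes from the sample and independence over k from the
    product form of mu, so the whole array of entries X_k^i is independent. *)
Lemma sample_entries (C : 'I_N -> forall k, set (S k)) :
    (forall i k, measurable (C i k)) ->
  Pr [set w | forall i k, C i k (X i w k)] = \prod_k \prod_i mu_ k (C i k).
Proof.
case: hX => lawX indepX mC.
have mB i : measurable (box (C i)) by exact: measurable_box.
transitivity (Pr (\bigcap_(i in [set` [set: 'I_N]%SET]) X i @^-1` box (C i))).
  congr (Pr _); apply/seteqP; split=> w /= Cw i => [_ k|k]; first exact: Cw.
  by apply: Cw; rewrite /= finset.inE.
rewrite indepX// (eq_bigl xpredT) => [|i]; last by rewrite finset.inE.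
rewrite exchange_big/=; apply: eq_bigr => i _.
by rewrite -prod_probE// -(lawX i).
Qed.

Lemma has_law_recombine n : has_law Pr mu (recombine n).
Proof.
apply: has_law_box => [|A mA]; first exact: measurable_recombine.
rewrite prod_probE//.
pose C i k := if i == n k then A k else setT.
transitivity (\prod_k \prod_i mu_ k (C i k)); last first.
  apply: eq_bigr => k _; rewrite (bigD1 (n k))//= /C eqxx big1 ?mule1//.
  by move=> i /negPf ->; exact: probability_setT.
rewrite -sample_entries; last by move=> i k; rewrite /C; case: ifP.
congr (Pr _); apply/seteqP; split=> w /= Aw => [i k|k].
  by rewrite /C; case: eqP => // ->; exact: Aw.
by have := Aw (n k) k; rewrite /C eqxx.
Qed.

Lemma has_law_recombine_pair n m : (forall k, n k != m k) ->
  has_law Pr (mu \x mu) (fun w => (recombine n w, recombine m w)).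
Proof.
move=> nm; apply: has_law_pair_box; [exact: has_law_recombine..|].
move=> A B mA mB; rewrite !prod_probE// -big_split/=.
pose C i k := if i == n k then A k else if i == m k then B k else setT.
transitivity (\prod_k \prod_i mu_ k (C i k)); last first.
  (* For fixed k, only the two rows n k and m k carry a constraint. *)
  apply: eq_bigr => k _; rewrite (bigD1 (n k))//= (bigD1 (m k))/=; last first.
    by rewrite eq_sym.
  rewrite /C eqxx eq_sym (negPf (nm k)) eqxx big1 ?mule1//.
  by move=> i /andP[/negPf -> /negPf ->]; exact: probability_setT.
rewrite -sample_entries; last by move=> i k; rewrite /C; do 2?case: ifP.
congr (Pr _); apply/seteqP; split=> w /=.
  move=> [Aw Bw] i k; rewrite /C; case: eqP => [->|_]; first exact: Aw.
  by case: eqP => // ->; exact: Bw.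
move=> Cw; split=> k; first by have := Cw (n k) k; rewrite /C eqxx.
by have := Cw (m k) k; rewrite /C eqxx eq_sym (negPf (nm k)).
Qed.

Variable phi : pspace S -> R.
Hypothesis phi2 : phi \in Lfun mu 2%:E.

Lemma variance_disjoint_average (n : 'I_N -> 'I_K -> 'I_N) : (0 < N)%N ->
    (forall s t k, s != t -> n s k != n t k) ->
  'V_Pr[(N%:R^-1 \o* (\sum_s (phi \o recombine (n s))))%R] =
  (N%:R^-1)%:E * sigma2 mu phi.
Proof.
move=> N0 nst.
have Y2 s : phi \o recombine (n s) \in Lfun Pr 2%:E.
  exact (Lfun2_law (has_law_recombine (n s)) phi2).
rewrite varianceZ; last exact: Lfun2_sum.
rewrite variance_sum_uncorrelated//; last first.
  move=> s t st; apply: covariance_pair phi2 phi2;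
    [exact: has_law_recombine..|].
  by apply: has_law_recombine_pair => k; exact: nst.
under eq_bigr => s _ do rewrite
  (variance_law (has_law_recombine _) (Lfun_measurable phi2)).
rewrite sigma2_variance -(fineK (variance_fin_num phi2)) sumEFin -!EFinM.
congr (_%:E).
rewrite sumr_const card_ord -[X in (_ * X)%R]mulr_natl expr2 mulrACA.
rewrite mulVf ?mul1r//.
by rewrite pnatr_eq0 -lt0n.
Qed.

End samples.

(** * The main effects of a function on a product space *)

Section marginals.
Local Open Scope ereal_scope.
Context {R : realType} {K : nat} {d : 'I_K -> measure_display}
  {S : forall k, measurableType (d k)} (mu_ : forall k, probability (S k) R).
Local Notation mu := (prod_prob mu_).
Local Notation nu k := (sub_prod_prob mu_ [set~ k]%SET).

Lemma has_law_coord k : has_law mu (mu_ k) (fun x => x k).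
Proof.
split=> [|A mA]; first exact: measurable_coord.
rewrite -[X in mu X]/([set x : pspace S | A (x k)]) cylinder_box prod_probE.
  rewrite (bigD1 k)//= dfwith_in big1 ?mule1// => j jk.
  by rewrite dfwith_out 1?eq_sym//; exact: probability_setT.
by move=> j; case: eqtype.dfwithP.
Qed.

Lemma has_law_coord_pair k l : k != l ->
  has_law mu (mu_ k \x mu_ l) (fun x => (x k, x l)).
Proof.
move=> kl; apply: has_law_pair; [exact: has_law_coord..|].
move=> A B mA mB.
pose C := eqtype.dfwith (eqtype.dfwith (fun j => [set: S j]) B) A.
have -> : (fun x : pspace S => x k) @^-1` A `&` (fun x => x l) @^-1` B = box C.
  apply/seteqP; split=> x /=.
    move=> [Ax Bx] j; rewrite /C; case: eqtype.dfwithP => // j' _.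
    by case: eqtype.dfwithP.
  move=> Cx; split; first by have := Cx k; rewrite /C dfwith_in.
  by have := Cx l; rewrite /C dfwith_out// dfwith_in.
rewrite prod_probE; last first.
  by move=> j; rewrite /C; case: eqtype.dfwithP => // j' _; case: eqtype.dfwithP.
rewrite (bigD1 k)//= (bigD1 l)/=; last by rewrite eq_sym.
rewrite /C dfwith_in dfwith_out// dfwith_in big1 ?mule1// => j /andP[jk jl].
by rewrite !dfwith_out 1?eq_sym//; exact: probability_setT.
Qed.

(** The decomposition S_k x prod_(j <> k) S_j = S that is behind the marginal;
    it turns integrals over S into iterated integrals. *)
Definition insert_coord k (z : S k * @subpspace K d S [set~ k]%SET) : pspace S :=
  Defs.glue (single z.1) z.2.

Lemma insert_coord_same k z : @insert_coord k z k = z.1.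
Proof. exact: glue_single. Qed.

Lemma insert_coord_other k z (j : {j | j \in [set~ k]%SET}) :
  @insert_coord k z (val j) = z.2 j.
Proof. exact: glue_in. Qed.

Lemma measurable_insert_coord k :
  measurable_fun [set: (S k * @subpspace K d S [set~ k]%SET)%type]
    (@insert_coord k).
Proof.
apply: measurable_pspaceP => j.
have [<-|jk] := eqVneq k j.
  rewrite (_ : (fun z => insert_coord z k) = fst); first exact: measurable_fst.
  by apply/funext => z; exact: insert_coord_same.
have jk' : j \in [set~ k]%SET by rewrite finset.inE finset.in_set1 eq_sym.
rewrite (_ : (fun z => insert_coord z j) = (fun y => y (exist _ j jk')) \o snd);
  last by apply/funext => z; exact: (insert_coord_other z (exist _ j jk')).
exact: (measurableT_comp
  (@measurable_coord _ _ (fun i : {i | i \in [set~ k]%SET} => S (val i))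
    (exist _ j jk')) measurable_snd).
Qed.

Lemma has_law_insert_coord k : has_law (mu_ k \x nu k) mu (@insert_coord k).
Proof.
apply: has_law_box => [|B mB]; first exact: measurable_insert_coord.
have -> : @insert_coord k @^-1` box B =
    B k `*` box (fun j : {j | j \in [set~ k]%SET} => B (val j)).
  apply/seteqP; split=> -[t y] /=.
    move=> Bty; split=> [|j /=].
      by have := Bty k; rewrite insert_coord_same.
    by have := Bty (val j); rewrite insert_coord_other.
  move=> [Bt By] j; have [<-|jk] := eqVneq k j.
    by rewrite insert_coord_same.
  have jk' : j \in [set~ k]%SET by rewrite finset.inE finset.in_set1 eq_sym.
  by rewrite (insert_coord_other _ (exist _ j jk')); exact: (By (exist _ j jk')).
rewrite [LHS]product_measure1E//; last first.
  by apply: measurable_box => j; exact: mB.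
rewrite [RHS]prod_probE// (bigD1 k)//=; congr (_ * _).
rewrite [LHS](@prod_probE _ _ _ _ (fun j : {j | j \in [set~ k]%SET} =>
  mu_ (val j)) (fun j => B (val j))) => [|j]; last exact: mB.
rewrite -(big_sub (mem [set~ k]%SET) (fun i => mu_ i (B i))).
by apply: eq_bigl => j; rewrite finset.inE finset.in_set1.
Qed.

Variable phi : pspace S -> R.
Hypothesis phi2 : phi \in Lfun mu 2%:E.
Hypothesis hpart : partial_integrals_defined mu_ phi.

Lemma integrable_slice k (t : S k) :
  (nu k).-integrable setT (fun y => (phi (insert_coord (t, y)))%:E).
Proof. exact: (hpart (single t)). Qed.

(** The marginal is a real-valued integral; since every slice is integrable it
    coincides, at every point, with the inner integral of Fubini's theorem. *)
Lemma EFin_marginal k (t : S k) :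
  (marginal mu_ phi t)%:E = \int[nu k]_y (phi (insert_coord (t, y)))%:E.
Proof.
rewrite /marginal /partial_integral fineK// integrable_fin_num//.
exact: (hpart (single t)).
Qed.

Let phi_ins2 k : phi \o @insert_coord k \in Lfun (mu_ k \x nu k) 2%:E.
Proof. exact: (Lfun2_law (has_law_insert_coord k) phi2). Qed.

Let integrable_ins k :
  (mu_ k \x nu k).-integrable setT (EFin \o (phi \o @insert_coord k)).
Proof. exact/Lfun1_integrable/Lfun2_Lfun1/phi_ins2. Qed.

Lemma measurable_marginal k : measurable_fun [set: S k] (marginal mu_ phi (k := k)).
Proof.
apply/measurable_EFinP.
have := measurable_fubini_F (integrable_ins k).
by congr (measurable_fun _ _); apply/funext => t /=; rewrite EFin_marginal.
Qed.

Lemma expectation_marginal k : 'E_(mu_ k)[marginal mu_ phi (k := k)] = 'E_mu[phi].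
Proof.
rewrite -(expectation_law (has_law_insert_coord k) (Lfun_measurable phi2)).
rewrite expectation.unlock.
have := integral12_prod_meas1 (integrable_ins k).
by move=> <-; apply: eq_integral => t _; rewrite EFin_marginal.
Qed.

(** By Jensen on each slice, the square of the marginal is at most the slice
    integral of phi^2; Tonelli concludes. *)
Lemma Lfun2_marginal k : marginal mu_ phi (k := k) \in Lfun (mu_ k) 2%:E.
Proof.
apply: Lfun2P; first exact: measurable_marginal.
have phi_sq : measurable_fun [set: (S k * @subpspace K d S [set~ k]%SET)%type]
    (fun z => (phi (insert_coord z) ^+ 2)%:E).
  apply/measurable_EFinP/measurable_funX.
  exact: (Lfun_measurable (phi_ins2 k)).
apply: le_lt_trans (Lfun2_lty (phi_ins2 k)).
rewrite [leRHS](fubini_tonelli1 (fun z => (phi (insert_coord z) ^+ 2)%:E))//.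
- apply: ge0_le_integral => //.
  + by move=> t _; rewrite lee_fin sqr_ge0.
  + by apply/measurable_EFinP/measurable_funX; exact: measurable_marginal.
  + apply: measurable_fun_fubini_tonelli_F => // z.
    by rewrite lee_fin sqr_ge0.
  + move=> t _; rewrite /fubini_F.
    have := @sqr_expectation_le _ _ _ (nu k) (fun y => phi (insert_coord (t, y))).
    rewrite expectation.unlock -EFin_marginal; apply.
    by apply/Lfun1_integrable; exact: integrable_slice.
- by move=> z; rewrite lee_fin sqr_ge0.
Qed.

Lemma variance_marginal k :
  'V_(mu_ k)[marginal mu_ phi (k := k)] =
  \int[mu_ k]_t ((marginal mu_ phi t - mean mu phi) ^+ 2)%:E.
Proof.
rewrite /variance covariance.unlock expectation_marginal.
by rewrite !expectation.unlock.
Qed.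

(** The conditional expectation of phi given the k-th coordinate. *)
Definition main_effect k (x : pspace S) : R := marginal mu_ phi (x k).

Lemma Lfun2_main_effect k : main_effect k \in Lfun mu 2%:E.
Proof. exact: (Lfun2_law (has_law_coord k) (Lfun2_marginal k)). Qed.

Lemma variance_main_effect k :
  'V_mu[main_effect k] = 'V_(mu_ k)[marginal mu_ phi (k := k)].
Proof. exact: (variance_law (has_law_coord k) (@measurable_marginal k)). Qed.

Lemma covariance_main_effects k l : k != l ->
  covariance mu (main_effect k) (main_effect l) = 0.
Proof.
move=> kl; exact: (covariance_pair (has_law_coord k) (has_law_coord l)
  (has_law_coord_pair kl) (Lfun2_marginal k) (Lfun2_marginal l)).
Qed.

(** The function main_effect k only depends on the k-th coordinate: in the
    inner integral over the other coordinates it is a constant factor, and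
    what remains of phi is its marginal.  So E[phi h_k] = E[h_k^2]. *)
Lemma covariance_main_effect k :
  covariance mu phi (main_effect k) = 'V_mu[main_effect k].
Proof.
have h2 := Lfun2_main_effect k.
have ph1 := Lfun2_mul_Lfun1 phi2 h2.
have hE : 'E_mu[main_effect k] = 'E_mu[phi].
  rewrite -(expectation_marginal k).
  exact: (expectation_law (has_law_coord k) (@measurable_marginal k)).
rewrite (covarianceE (Lfun2_Lfun1 phi2) (Lfun2_Lfun1 h2) ph1) variance_main_effect.
rewrite varianceE ?Lfun2_marginal// expectation_marginal hE -expe2.
congr (_ - _).
rewrite -(expectation_law (has_law_insert_coord k) (Lfun_measurable ph1)).
have hins2 := Lfun2_law (has_law_insert_coord k) h2.
have := Lfun2_mul_Lfun1 (phi_ins2 k) hins2.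
move=> /Lfun1_integrable/integral12_prod_meas1 phE.
rewrite expectation.unlock.
transitivity (\int[mu_ k \x nu k]_z (EFin \o ((phi \o @insert_coord k) \*
  (main_effect k \o @insert_coord k))%R) z) => //.
rewrite -phE; apply: eq_integral => t _.
transitivity (\int[nu k]_y
    ((phi (insert_coord (t, y)))%:E * (marginal mu_ phi t)%:E)).
  by apply: eq_integral => y _; rewrite /= /main_effect insert_coord_same.
rewrite integralZr//; last exact: integrable_slice.
by rewrite -EFin_marginal.
Qed.

Lemma sigma2_prod_le : sigma2_prod mu_ phi <= sigma2 mu phi.
Proof.
rewrite sigma2_variance /sigma2_prod.
under eq_bigr do rewrite -variance_marginal -variance_main_effect.
apply: bessel => //.
- exact: Lfun2_main_effect.
- by move=> k l; exact: covariance_main_effects.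
- exact: covariance_main_effect.
Qed.

End marginals.

(** * The two estimators *)

Section estimators_variance.
Local Open Scope ereal_scope.
(* The sample size is N.+1, so that the indices form the group Z/(N+1). *)
Context {R : realType} {K N : nat} {d : 'I_K -> measure_display}
  {S : forall k, measurableType (d k)} (mu_ : forall k, probability (S k) R)
  {dO : measure_display} {Omega : measurableType dO}
  (Pr : probability Omega R) (X : 'I_N.+1 -> {mfun Omega >-> pspace S}).
Hypothesis hX : iid_sample Pr (prod_prob mu_) X.
Variable phi : pspace S -> R.
Hypothesis phi2 : phi \in Lfun (prod_prob mu_) 2%:E.

Lemma variance_standard_estimator :
  'V_Pr[standard_estimator X phi] = (N.+1%:R^-1)%:E * sigma2 (prod_prob mu_) phi.
Proof.
rewrite -(variance_disjoint_average hX phi2 (n := fun s _ => s))//.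
congr (variance _ _); apply/funext => w.
by rewrite /standard_estimator /= fct_sumE mulrC.
Qed.

(** The standard estimator of the sample X^(n + s), with s in Z/(N+1). *)
Definition shifted_estimator (n : {ffun 'I_K -> 'I_N.+1}) : Omega -> R :=
  (N.+1%:R^-1 \o* (\sum_(s < N.+1) (phi \o recombine X (fun k => (n k + s)%R))))%R.

(** For each fixed s, n |-> n + s permutes the multi-indices, so each shift
    contributes the full sum over the multi-indices. *)
Lemma product_estimator_shifts :
  product_estimator X phi =
  (#|{ffun 'I_K -> 'I_N.+1}|%:R^-1 \o* (\sum_n shifted_estimator n))%R.
Proof.
apply/funext => w; rewrite /product_estimator /= card_ffun !card_ord natrX.
rewrite mulrC fct_sumE; congr (_ * _)%R.
under [RHS]eq_bigr do rewrite /shifted_estimator /= fct_sumE.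
rewrite -mulr_suml exchange_big /=.
pose F (n : {ffun 'I_K -> 'I_N.+1}) := phi (recombine X n w).
have shiftE s : (\sum_(n : {ffun 'I_K -> 'I_N.+1})
    phi (recombine X (fun k => n k + s)%R w) = \sum_n F n)%R.
  pose shift s (n : {ffun 'I_K -> 'I_N.+1}) := [ffun k => (n k + s)%R].
  have shiftK : cancel (shift (- s)%R) (shift s).
    by move=> n; apply/ffunP => k; rewrite !ffunE subrK.
  have shiftK' : cancel (shift s) (shift (- s)%R).
    by move=> n; apply/ffunP => k; rewrite !ffunE addrK.
  rewrite [RHS](reindex (shift s))/=; last by exists (shift (- s)%R) => n _.
  apply: eq_bigr => n _; congr (phi _).
  by apply: functional_extensionality_dep => k; rewrite /recombine ffunE.
rewrite (eq_bigr _ (fun s _ => shiftE s)) sumr_const card_ord.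
rewrite -[X in (X * _)%R]mulr_natr.
by rewrite mulfK// pnatr_eq0.
Qed.

Lemma variance_product_estimator_le :
  'V_Pr[product_estimator X phi] <= (N.+1%:R^-1)%:E * sigma2 (prod_prob mu_) phi.
Proof.
rewrite sigma2_variance -(fineK (variance_fin_num phi2)) -EFinM.
rewrite product_estimator_shifts; apply: variance_average_le.
- by rewrite card_ffun !card_ord expn_gt0.
- move=> n; rewrite /shifted_estimator Lfun_scale ?ler1n//.
  apply: Lfun2_sum => s.
  exact: (Lfun2_law (has_law_recombine hX _) phi2).
- move=> n; rewrite /shifted_estimator (variance_disjoint_average hX phi2)//.
    by rewrite sigma2_variance EFinM fineK// variance_fin_num.
  by move=> s t k; apply: contra_neq => /addrI.
Qed.

End estimators_variance.

Theorem corollary1 (R : realType) (K : nat) (hK : (1 < K)%N)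
    (d : 'I_K -> measure_display) (S : forall k, measurableType (d k))
    (mu_ : forall k, probability (S k) R) (phi : pspace S -> R)
    (hphi : phi \in Lfun (prod_prob mu_) 2%:E)
    (hpart : partial_integrals_defined mu_ phi) :
  (forall (N : nat) (hN : (0 < N)%N)
      (dO : measure_display) (Omega : measurableType dO)
      (Pr : probability Omega R) (X : 'I_N -> {mfun Omega >-> pspace S})
      (hX : iid_sample Pr (prod_prob mu_) X),
    (variance Pr (product_estimator X phi)
       <= (N%:R^-1)%:E * sigma2 (prod_prob mu_) phi)%E /\
    ((N%:R^-1)%:E * sigma2 (prod_prob mu_) phi
       = variance Pr (standard_estimator X phi))%E) /\
  (sigma2_prod mu_ phi <= sigma2 (prod_prob mu_) phi)%E.
Proof.
split; last exact: sigma2_prod_le.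
move=> [//|N] _ dO Omega Pr X hX; split.
  exact: variance_product_estimator_le.
by rewrite (variance_standard_estimator hX).
Qed.
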